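(* Let $d\ge1$ and write $A_j(d,t)=\sum_{k=0}^{d-1}a_j(d,k)t^k$. For all $1\le j\le d$ the coefficients of $A_j(d,t)$ are unimodal. More specifically, if $d$ is even then $a_j(d,0)\le\cdots\le a_j(d,\tfrac d2-1)\ge\cdots\ge a_j(d,d-1)$ if $1\le j\le\tfrac d2$, and $a_j(d,0)\le\cdots\le a_j(d,\tfrac d2)\ge\cdots\ge a_j(d,d-1)$ if $\tfrac d2<j\le d$; and if $d\ge3$ is odd then $a_1(d,0)\le\cdots\le a_1(d,\lfloor\tfrac d2\rfloor-1)=a_1(d,\lfloor\tfrac d2\rfloor)\ge\cdots\ge a_1(d,d-1)$, $a_d(d,0)\le\cdots\le a_d(d,\lfloor\tfrac d2\rfloor)=a_d(d,\lfloor\tfrac d2\rfloor+1)\ge\cdots\ge a_d(d,d-1)$, and $a_j(d,0)\le\cdots\le a_j(d,\lfloor\tfrac d2\rfloor)\ge\cdots\ge a_j(d,d-1)$ for $2\le j\le d-1$.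
   Context: For $\sigma=\sigma_1\cdots\sigma_d\in S_d$, $\operatorname{des}(\sigma)=|\{i\in[d-1]:\sigma_i>\sigma_{i+1}\}|$. For $1\le j\le d$, $a_j(d,k)$ is the number of $\sigma\in S_d$ with $\sigma_d=d+1-j$ and $\operatorname{des}(\sigma)=k$, and $A_j(d,t)=\sum_{k=0}^{d-1}a_j(d,k)t^k$. *)

(* Defs.v *)
From mathcomp Require Import all_boot all_order all_algebra all_fingroup.

Set Implicit Arguments.
Unset Strict Implicit.
Unset Printing Implicit Defensive.

(* A permutation sigma of {1, ..., d} is encoded as s : 'S_d acting on
   {0, ..., d-1}, with sigma_(i+1) = s i + 1. *)

Definition des (d : nat) (s : 'S_d) : nat :=
  #|[set i : 'I_d | [exists i' : 'I_d, (i' == i.+1 :> nat) && (s i' < s i)]]|.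

(* The word of s, read in 1-based values, ends with v. *)
Definition ends_with (d : nat) (s : 'S_d) (v : nat) : bool :=
  [exists i : 'I_d, (i.+1 == d) && ((s i).+1 == v)].

Definition a_ (j d k : nat) : nat :=
  #|[set s : 'S_d | ends_with s (d + 1 - j) && (des s == k)]|.

Definition A_ (j d : nat) : {poly nat} := \poly_(k < d) a_ j d k.

(* c m <= c (m+1) <= ... <= c n *)
Definition nondecreasing_between (c : nat -> nat) (m n : nat) : Prop :=
  forall k, m <= k -> k < n -> c k <= c k.+1.

(* c m >= c (m+1) >= ... >= c n *)
Definition nonincreasing_between (c : nat -> nat) (m n : nat) : Prop :=
  forall k, m <= k -> k < n -> c k >= c k.+1.

(* c 0 <= ... <= c p >= ... >= c n *)
Definition peak_at (c : nat -> nat) (n p : nat) : Prop :=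
  nondecreasing_between c 0 p /\ nonincreasing_between c p n.

(* The finite sequence c 0, ..., c n is unimodal. *)
Definition unimodal (c : nat -> nat) (n : nat) : Prop :=
  exists2 p, p <= n & peak_at c n p.

(* Main.v *)
Require Import Defs.
From mathcomp Require Import all_boot all_order all_algebra all_fingroup.
From mathcomp Require Import zify.

(* Deleting the last letter of a permutation and standardizing gives a
   recurrence for the numbers of permutations with prescribed last letter and
   number of descents; the recurrence is invariant under complementation
   [(u, k) |-> (d - 1 - u, d - 1 - k)].  The shape of the sequences follows by
   induction on [d].  All comparisons of consecutive terms hold summand by
   summand except near the middle.  From even [d] to odd [d + 1] the middle
   comparison uses that the two central Eulerian numbers of [d] agree, so a sum
   over part of the last letters can be traded for the sum over the other ones;
   from odd [d] to even [d + 1], the symmetry turns both sides into sums of the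
   same two sequences over intervals one of which contains the other. *)

(** * Deleting the last letter *)

Lemma lift_perm_inj {n} (i j : 'I_n.+1) : injective (lift_perm i j).
Proof.
move=> s t e; apply/permP => k; apply: (@lift_inj _ j).
by rewrite -!(lift_perm_lift i) e.
Qed.

Lemma lift_perm_surj {n} (i : 'I_n.+1) (s : 'S_n.+1) :
  exists t, s = lift_perm i (s i) t.
Proof.
have ex k : exists k', s (lift i k) = lift (s i) k'.
  case: (unliftP (s i) (s (lift i k))) => [k' e|/perm_inj e]; first by exists k'.
  by have := neq_lift i k; rewrite e eqxx.
have [f fE] := fin_all_exists ex.
have f_inj : injective f.
  by move=> x y e; apply/(@lift_inj _ i)/(@perm_inj _ s); rewrite !fE e.
exists (perm f_inj); apply/permP => k.
case: (unliftP i k) => [k'|] ->; last by rewrite lift_perm_id.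
by rewrite lift_perm_lift permE fE.
Qed.

Lemma desE {n} (s : 'S_n.+1) :
  des s = \sum_(i < n) (s (lift ord0 i) < s (lift ord_max i)).
Proof.
rewrite /des -sum1dep_card big_mkcond big_ord_recr /= [X in _ + X]ifF ?addn0.
  apply: eq_bigr => i _.
  have -> : widen_ord (leqnSn n) i = lift ord_max i.
    by apply/ord_inj; rewrite lift_max.
  congr nat_of_bool; apply/existsP/idP => [[i' /andP[/eqP e]]|h].
    suff -> : i' = lift ord0 i by [].
    by apply/ord_inj; rewrite e lift0.
  by exists (lift ord0 i); rewrite h andbT lift0.
by apply/existsP => -[i' /andP[/eqP e _]]; have := ltn_ord i'; rewrite e ltnn.
Qed.

(** Lifting preserves comparisons among the old letters. The one new adjacent pair is
    [lift v (s ord_max)], [v], a descent exactly when [s ord_max] gets shifted past [v]. *)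
Lemma des_lift_perm {n} (v : 'I_n.+2) (s : 'S_n.+1) :
  des (lift_perm ord_max v s) = des s + (v <= s ord_max).
Proof.
have ltn_lift (x y : 'I_n.+1) : (lift v x < lift v y) = (x < y).
  by rewrite !ltnNge leq_bump2.
rewrite !desE big_ord_recr /=; congr (_ + _).
  apply: eq_bigr => i _.
  have -> : widen_ord (leqnSn n) i = lift ord_max i.
    by apply/ord_inj; rewrite lift_max.
  have -> : lift ord0 (lift ord_max i) = lift ord_max (lift ord0 i) :> 'I_n.+2.
    by apply/val_inj; rewrite /= /bump /=; have := ltn_ord i; lia.
  by rewrite !lift_perm_lift ltn_lift.
have -> : lift ord0 ord_max = ord_max :> 'I_n.+2 by apply/val_inj.
by rewrite lift_perm_lift lift_perm_id /= /bump; lia.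
Qed.

Definition last_des_count {n} (u : 'I_n.+1) k :=
  #|[set s : 'S_n.+1 | (s ord_max == u) && (des s == k)]|.

Lemma last_des_countS n (v : 'I_n.+2) k :
  last_des_count v k =
  \sum_(u < n.+1 | u < v) last_des_count u k +
  \sum_(u < n.+1 | v <= u) (if k is k'.+1 then last_des_count u k' else 0).
Proof.
have -> : last_des_count v k =
    #|[set s : 'S_n.+1 | des (lift_perm ord_max v s) == k]|.
  rewrite /last_des_count -(card_imset _ (lift_perm_inj ord_max v)).
  apply: eq_card => s; rewrite inE; apply/andP/imsetP => [[/eqP e dk]|[t]].
    have [t st] := lift_perm_surj ord_max s.
    by exists t; rewrite ?inE -e -st.
  by rewrite inE => dk ->; rewrite lift_perm_id eqxx dk.
(* Classify by the new last letter [u] after the deletion: the deleted [v] had created a descent iff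
   [v <= u]. *)
rewrite -sum1dep_card (partition_big (fun s : 'S_n.+1 => s ord_max) predT) //=.
rewrite (bigID (fun u : 'I_n.+1 => u < v)) /=; congr (_ + _).
  apply: eq_bigr => u uv; rewrite sum1dep_card; apply: eq_card => s.
  rewrite !inE des_lift_perm andbC; case: eqP => //= ->.
  by rewrite leqNgt uv addn0.
apply: eq_big => u; first by rewrite -leqNgt.
rewrite -leqNgt => vu; rewrite sum1dep_card.
have E (s : 'S_n.+1) : (des (lift_perm ord_max v s) == k) && (s ord_max == u)
    = (s ord_max == u) && ((des s).+1 == k).
  by rewrite des_lift_perm andbC; case: eqP => //= ->; rewrite vu addn1.
case: k E => [|k] E; last by apply: eq_card => s; rewrite !inE E.
by apply/eqP; rewrite cards_eq0; apply/eqP/setP => s; rewrite !inE E andbF.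
Qed.

(** * The recurrence as a numerical function *)

(* [refined_eulerian n u k.+1] counts the permutations of [n.+1] letters with
   [k] descents and 0-based last letter [u]; the shift of [k] makes the value at
   [0] stand for "minus one descents", so that the recurrence is uniform. *)
Fixpoint refined_eulerian (n u k : nat) : nat :=
  if k is k'.+1 then
    if n is n'.+1 then
      \sum_(0 <= i < u) refined_eulerian n' i k +
      \sum_(u <= i < n) refined_eulerian n' i k'
    else k' == 0
  else 0.
Arguments refined_eulerian : simpl never.

Lemma refined_eulerian0 n u : refined_eulerian n u 0 = 0.
Proof. by case: n. Qed.

Lemma refined_eulerianS n u k : refined_eulerian n.+1 u k.+1 =
  \sum_(0 <= i < u) refined_eulerian n i k.+1 +
  \sum_(u <= i < n.+1) refined_eulerian n i k.
Proof. by []. Qed.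

Lemma last_des_countE n (u : 'I_n.+1) k :
  last_des_count u k = refined_eulerian n u k.+1.
Proof.
elim: n u k => [|n IH] u k.
  have des0 (s : 'S_1) : des s = 0 by rewrite desE big_ord0.
  rewrite /last_des_count /refined_eulerian.
  have E (s : 'S_1) : (s ord_max == u) && (des s == k) = (k == 0).
    by rewrite des0 (ord1 (s _)) (ord1 u) eqxx eq_sym.
  case: eqP => k0.
    transitivity #|'S_1|; last by rewrite card_Sn.
    by apply: eq_card => s; rewrite !inE E k0 eqxx.
  by apply: eq_card0 => s; rewrite !inE E; apply/eqP.
have un : u <= n.+1 by rewrite -ltnS.
rewrite last_des_countS refined_eulerianS; congr (_ + _).
  under [LHS]eq_bigr do rewrite IH.
  rewrite -(big_ord_widen _ (fun i => refined_eulerian n i k.+1) un).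
  by rewrite big_mkord.
have -> : \sum_(u <= i < n.+1) refined_eulerian n i k =
          \sum_(i < n.+1 | u <= i) refined_eulerian n i k.
  by rewrite (big_nat_widenl _ 0) // big_mkord.
apply: eq_bigr => i _; case: k => [|k]; [by rewrite refined_eulerian0|exact: IH].
Qed.

Lemma a_E n j k : 1 <= j <= n.+1 ->
  a_ j n.+1 k = refined_eulerian n (n.+1 - j) k.+1.
Proof.
move=> hj; have hu : n.+1 - j < n.+1 by lia.
rewrite -(last_des_countE n (Ordinal hu)); apply: eq_card => s; rewrite !inE.
congr (_ && _); apply/existsP/eqP => [[i /andP[/eqP[i_n] /eqP e]]|e].
  have <- : i = ord_max by apply/val_inj.
  by apply/val_inj => /=; lia.
by exists ord_max; rewrite eqxx e /=; apply/eqP; lia.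
Qed.

(** * Sums over intervals and the complementation symmetry *)

Lemma leq_sum_nat m n (F G : nat -> nat) :
  (forall i, m <= i < n -> F i <= G i) ->
  \sum_(m <= i < n) F i <= \sum_(m <= i < n) G i.
Proof.
move=> h; rewrite big_nat_cond [leqRHS]big_nat_cond.
by apply: leq_sum => i /andP[/h].
Qed.

Lemma sum_nat_reflect m n p (F G : nat -> nat) : m <= n <= p ->
  (forall i, m <= i < n -> F i = G (p - i.+1)) ->
  \sum_(m <= i < n) F i = \sum_(p - n <= i < p - m) G i.
Proof.
case/andP; elim: n => [|n IH]; first by move=> *; rewrite !big_geq //; lia.
rewrite leq_eqVlt => /predU1P[->|mn] np h; first by rewrite !big_geq.
rewrite big_nat_recr //= IH //; [|lia|by move=> i hi; apply: h; lia].
rewrite h; last by lia.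
rewrite [RHS]big_ltn; last by lia.
by rewrite addnC subnSK.
Qed.

Lemma refined_eulerian_gt n u k : u <= n -> n.+1 < k ->
  refined_eulerian n u k = 0.
Proof.
elim: n u k => [|n IH] u [|[|k]] un nk //.
apply/eqP; rewrite refined_eulerianS addn_eq0 !sum_nat_seq_eq0.
by apply/andP; split; apply/allP => i; rewrite mem_index_iota => hi;
  rewrite IH //; lia.
Qed.

(** Reflecting the summation index swaps the two sums of the recurrence. As both [k] and [k'] are
    shifted by one, descent numbers adding up to [n] give [n.+2]. *)
Lemma refined_eulerian_sym n u k k' : u <= n -> k + k' = n.+2 ->
  refined_eulerian n u k = refined_eulerian n (n - u) k'.
Proof.
elim: n u k k' => [|n IH] u k k' un.
  by case: k k' => [|[|[|k]]] [|[|[|k']]] //; lia.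
case: k k' => [|k] [|k'] kk //.
- by rewrite refined_eulerian0 refined_eulerian_gt //; lia.
- by rewrite refined_eulerian0 refined_eulerian_gt //; lia.
rewrite !refined_eulerianS addnC; congr (_ + _).
  rewrite (sum_nat_reflect _ _ n.+1 _ (fun i => refined_eulerian n i k'.+1)).
  - by rewrite subnn.
  - by rewrite un leqnn.
  - by move=> i hi; rewrite (IH _ _ k'.+1) ?subSS; lia.
rewrite (sum_nat_reflect _ _ n.+1 _ (fun i => refined_eulerian n i k')).
- by rewrite subn0.
- by [].
- by move=> i hi; rewrite (IH _ _ k') ?subSS; lia.
Qed.

(** * Induction on the shape *)

(* The parity is that of the number of letters, [m.*2.+1] or [m.*2.+2]. *)
Definition odd_shape m := forall u, u <= m.*2 -> forall k,
  (k <= m -> refined_eulerian m.*2 u k <= refined_eulerian m.*2 u k.+1) /\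
  (m < k -> refined_eulerian m.*2 u k.+1 <= refined_eulerian m.*2 u k).

Definition even_shape m := forall u, u <= m.*2.+1 -> forall k,
  (k <= m + (u <= m) ->
     refined_eulerian m.*2.+1 u k <= refined_eulerian m.*2.+1 u k.+1) /\
  (m + (u <= m) < k ->
     refined_eulerian m.*2.+1 u k.+1 <= refined_eulerian m.*2.+1 u k).

Lemma odd_even_shape m : odd_shape m -> even_shape m.
Proof.
move=> H v hv [|k]; first by split; rewrite ?refined_eulerian0.
rewrite !refined_eulerianS; have [km|mk|->] := ltngtP k m.
- split=> hk; last by lia.
  by apply: leq_add; apply: leq_sum_nat => i hi; apply H; lia.
- split=> hk; first by lia.
  by apply: leq_add; apply: leq_sum_nat => i hi; apply H; lia.
(* Middle case: levels [m], [m.+1], [m.+2] occur, and symmetry sends [m.+2] to [m], leaving only [F]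
   and [G]. *)
pose F i := refined_eulerian m.*2 i m.+1.
pose G i := refined_eulerian m.*2 i m.
have GF i : i < m.*2.+1 -> G i <= F i by move=> hi; apply H; lia.
have reflF : \sum_(0 <= i < v) refined_eulerian m.*2 i m.+1 =
    \sum_(m.*2.+1 - v <= i < m.*2.+1) F i.
  rewrite -{2}[m.*2.+1]subn0; apply: sum_nat_reflect => // i hi.
  by rewrite /F (refined_eulerian_sym _ _ _ m.+1) ?subSS; lia.
have reflG : \sum_(0 <= i < v) refined_eulerian m.*2 i m.+2 =
    \sum_(m.*2.+1 - v <= i < m.*2.+1) G i.
  rewrite -{2}[m.*2.+1]subn0; apply: sum_nat_reflect => // i hi.
  by rewrite /G (refined_eulerian_sym _ _ _ m) ?subSS; lia.
rewrite reflF reflG.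
rewrite -/(\sum_(v <= i < m.*2.+1) F i) -/(\sum_(v <= i < m.*2.+1) G i).
split=> hk.
  (* Here [v <= m]; the common tail of the intervals cancels and [G <= F] on the rest decides. For
     [v > m] the intervals swap roles. *)
  have vw : v <= m.*2.+1 - v by lia.
  rewrite (big_cat_nat vw) ?leq_subr //=.
  rewrite [\sum_(v <= i < _) F i](big_cat_nat vw) ?leq_subr //=.
  have : \sum_(v <= i < m.*2.+1 - v) G i <= \sum_(v <= i < m.*2.+1 - v) F i.
    by apply: leq_sum_nat => i hi; apply: GF; lia.
  by lia.
have vw : m.*2.+1 - v <= v by lia.
rewrite (big_cat_nat vw) //= [\sum_(_ - _ <= i < _) F i](big_cat_nat vw) //=.
have : \sum_(m.*2.+1 - v <= i < v) G i <= \sum_(m.*2.+1 - v <= i < v) F i.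
  by apply: leq_sum_nat => i hi; apply: GF; lia.
by lia.
Qed.

Lemma sum_refined_eulerian_mid m :
  \sum_(0 <= i < m.*2.+2) refined_eulerian m.*2.+1 i m.+1 =
  \sum_(0 <= i < m.*2.+2) refined_eulerian m.*2.+1 i m.+2.
Proof.
rewrite (sum_nat_reflect _ _ m.*2.+2 _
  (fun i => refined_eulerian m.*2.+1 i m.+2)) ?subnn ?subn0 ?leqnn //.
by move=> i hi; rewrite (refined_eulerian_sym _ _ _ m.+2) ?subSS; lia.
Qed.

Lemma even_odd_shape m : even_shape m -> odd_shape m.+1.
Proof.
move=> H v; rewrite doubleS => hv [|k]; first by split; rewrite ?refined_eulerian0.
rewrite !refined_eulerianS; split=> hk.
  apply: leq_add; last by apply: leq_sum_nat => i hi; apply H; lia.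
  have [vm|mv] := leqP v m.+1.
    by apply: leq_sum_nat => i hi; apply H; lia.
  have [km|mk] := ltnP k m; first by apply: leq_sum_nat => i hi; apply H; lia.
  have -> : k = m by lia.
  (* Termwise comparison fails to apply to letters in [(m, v)]. The totals agree, so the reverse
     inequality on the letters [i >= v > m] suffices. *)
  have := sum_refined_eulerian_mid m; rewrite !(big_cat_nat (leq0n v) hv) /=.
  suff : \sum_(v <= i < m.*2.+2) refined_eulerian m.*2.+1 i m.+2 <=
         \sum_(v <= i < m.*2.+2) refined_eulerian m.*2.+1 i m.+1 by lia.
  by apply: leq_sum_nat => i hi; apply H; lia.
apply: leq_add; first by apply: leq_sum_nat => i hi; apply H; lia.
have [mv|vm] := ltnP m v; first by apply: leq_sum_nat => i hi; apply H; lia.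
have [mk|km] := ltnP m.+1 k; first by apply: leq_sum_nat => i hi; apply H; lia.
have -> : k = m.+1 by lia.
(* Dually, pass to the letters [i < v <= m]. *)
have := sum_refined_eulerian_mid m; rewrite !(big_cat_nat (leq0n v) hv) /=.
suff : \sum_(0 <= i < v) refined_eulerian m.*2.+1 i m.+1 <=
       \sum_(0 <= i < v) refined_eulerian m.*2.+1 i m.+2 by lia.
by apply: leq_sum_nat => i hi; apply H; lia.
Qed.

Lemma odd_shapeP m : odd_shape m.
Proof.
elim: m => [|m /odd_even_shape/even_odd_shape//] u _ k.
by case: k => [|[|k]].
Qed.

Lemma even_shapeP m : even_shape m.
Proof. exact/odd_even_shape/odd_shapeP. Qed.

(** * Translation to [a_] and [A_] *)

Lemma odd_peak m j : 1 <= j <= m.*2.+1 -> peak_at (a_ j m.*2.+1) m.*2 m.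
Proof.
move=> hj; split=> k mk km; rewrite !a_E //; apply odd_shapeP; lia.
Qed.

Lemma even_peak m j : 1 <= j <= m.*2.+2 ->
  peak_at (a_ j m.*2.+2) m.*2.+1 (m + (m.+1 < j)).
Proof.
move=> hj; split=> k mk km; rewrite !a_E //; apply even_shapeP; lia.
Qed.

Lemma peak_unimodal j d p : p < d -> peak_at (a_ j d) d.-1 p ->
  unimodal (fun k => ((A_ j d)`_k)%R) d.-1.
Proof.
move=> pd [up down]; exists p; first by lia.
by split=> k pk kd; rewrite !coef_poly !ifT; (apply: up || apply: down || idtac); lia.
Qed.

Theorem theorem3p4 (d : nat) (hd : 1 <= d) :
  (forall j, 1 <= j <= d -> unimodal (fun k => ((A_ j d)`_k)%R) d.-1) /\
  (~~ odd d ->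
     (forall j, 1 <= j <= d./2 -> peak_at (a_ j d) d.-1 d./2.-1) /\
     (forall j, d./2 < j <= d -> peak_at (a_ j d) d.-1 d./2)) /\
  (odd d -> 3 <= d ->
     [/\ nondecreasing_between (a_ 1 d) 0 d./2.-1,
         a_ 1 d d./2.-1 = a_ 1 d d./2 &
         nonincreasing_between (a_ 1 d) d./2 d.-1] /\
     [/\ nondecreasing_between (a_ d d) 0 d./2,
         a_ d d d./2 = a_ d d d./2.+1 &
         nonincreasing_between (a_ d d) d./2.+1 d.-1] /\
     (forall j, 2 <= j <= d.-1 -> peak_at (a_ j d) d.-1 d./2)).
Proof.
have [m [dE|dE]] : exists m, d = m.*2.+1 \/ d = m.*2.+2.
  by exists d.-1./2; lia.
- have d2 : d./2 = m by lia.
  split=> [j hj|]; first by apply: (@peak_unimodal j d m); [lia|subst d; apply: odd_peak].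
  split=> [|_ d3]; first by lia.
  rewrite d2; have peak j : 1 <= j <= d -> peak_at (a_ j d) d.-1 m.
    by subst d; apply: odd_peak.
  have [up1 down1] := peak 1 ltac:(lia).
  have [upd downd] := peak d ltac:(lia).
  split; last split; last by move=> j hj; apply: peak; lia.
    split=> //; first by move=> k _ km; apply: up1; lia.
    case: m dE {d2 peak up1 down1 upd downd} => [|m] dE; first by lia.
    (* With the largest last letter the second sum is empty, so both sides are the full sums at the
       two central levels. *)
    rewrite dE doubleS !a_E // !subSS subn0 !refined_eulerianS /=.
    by rewrite sum_refined_eulerian_mid !(@big_geq _ _ _ m.*2.+2).
  split=> //; last by move=> k mk km; apply: downd; lia.
  case: m dE {d2 peak up1 down1 upd downd} => [|m] dE; first by lia.
  (* With last letter 0 the first sum is empty, and the second, one level lower, gives the same full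
     sums. *)
  rewrite dE doubleS !a_E ?leqnn // subnn !refined_eulerianS.
  by rewrite sum_refined_eulerian_mid !(@big_geq _ _ _ 0 0).
have d2 : d./2 = m.+1 by lia.
have peak j : 1 <= j <= d -> peak_at (a_ j d) d.-1 (m + (m.+1 < j)).
  by subst d; apply: even_peak.
split=> [j hj|]; first by apply: peak_unimodal (peak j hj); lia.
split=> [_|]; last by lia.
rewrite d2; split=> j hj; have := peak j ltac:(lia).
  by rewrite ltnNge (proj2 (andP hj)) addn0.
by rewrite (proj1 (andP hj)) addn1.
Qed.
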